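(* Suppose that $f:\mathbb{R}\to\mathbb{R}$ is a continuously differentiable function such that there exist two real numbers $a$ and $b$, with $a<b$, for which the following conditions hold. (a) $f'(x)<0$ for all $x\le a$ and $f'(x)>0$ for all $x\ge b$. (b) $f'$ is strictly increasing and unbounded below on $(-\infty,a]$. (c) $f'$ is strictly increasing and unbounded above on $[b,\infty)$. Then there exists $t_0>0$ such that $\mu(\cdot,t)$ is strictly convex on $\mathbb{R}$ for all $t\ge t_0$, where $\mu$ is the Steklov function associated with $f$.
   Context: The Steklov function associated with a continuous function $f:\mathbb{R}\to\mathbb{R}$ is $\mu:\mathbb{R}\times(0,\infty)\to\mathbb{R}$, $\mu(x,t):=\frac{1}{2t}\int_{x-t}^{x+t}f(\tau)\,d\tau$. *)

(* Defs.v *)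
From Stdlib Require Import Reals.
From Coquelicot Require Import Coquelicot.

Local Open Scope R_scope.

(* The Steklov function is meaningful for t > 0 only; the values returned by
   this total function for t <= 0 are irrelevant.  [RInt] is the Riemann
   integral, which exists on every bounded interval when f is continuous. *)
Definition steklov (f : R -> R) (x t : R) : R :=
  / (2 * t) * RInt f (x - t) (x + t).

Definition continuously_differentiable (f : R -> R) : Prop :=
  (forall x : R, ex_derive f x) /\ (forall x : R, continuous (Derive f) x).

Definition strictly_increasing_on (D : R -> Prop) (g : R -> R) : Prop :=
  forall x y : R, D x -> D y -> x < y -> g x < g y.

Definition unbounded_below_on (D : R -> Prop) (g : R -> R) : Prop :=
  forall M : R, exists x : R, D x /\ g x < M.

Definition unbounded_above_on (D : R -> Prop) (g : R -> R) : Prop :=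
  forall M : R, exists x : R, D x /\ M < g x.

Definition strictly_convex (g : R -> R) : Prop :=
  forall x y lambda : R, x <> y -> 0 < lambda < 1 ->
    g (lambda * x + (1 - lambda) * y) < lambda * g x + (1 - lambda) * g y.

(* Main.v *)
Require Import Defs.
From Stdlib Require Import Reals Lra.
From Coquelicot Require Import Coquelicot.
Local Open Scope R_scope.

(** The derivative of [steklov f] in [x] is the difference quotient
    [(f (x + t) - f (x - t)) / (2 t)] ([is_derive_steklov]), whose own derivative
    has the sign of [f' (x + t) - f' (x - t)].  So everything reduces to comparing
    [f'] at two points at distance [2 t].  The two tails of [f'] are monotone and
    diverge to opposite infinities, while the middle part over [[a, b]] is
    bounded; so if one of two points lies in the possibly non-monotone middle
    part and the other is far away, [f'] at the far one has left the range of the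
    middle values on the correct side.  Hence [f'] is strictly larger at the right
    one of any two sufficiently distant points ([lt_of_far_apart]).  The distance needed does not depend on the points,
    which is why a single [t0] serves all [x].  Strict convexity then follows from
    the strict monotonicity of the derivative ([strictly_convex_of_deriv]). *)

Lemma increasing_of_deriv_pos (h dh : R -> R)
  (hd : forall x, is_derive h x (dh x)) (hpos : forall x, 0 < dh x)
  (x y : R) (hxy : x < y) :
  h x < h y.
Proof.
  destruct (MVT_cor2 h dh x y hxy) as [c [Hc _]].
  { intros c _; apply is_derive_Reals, hd. }
  pose proof (Rmult_lt_0_compat (dh c) (y - x) (hpos c) ltac:(lra)); lra.
Qed.

(** By the mean value theorem the chords on the two sides of an intermediate point
    have slopes [dh c1 < dh c2], and the convexity defect is a positive multiple of
    the difference of these slopes. *)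
Lemma strictly_convex_of_deriv (h dh : R -> R)
  (hd : forall x, is_derive h x (dh x))
  (hincr : forall x y, x < y -> dh x < dh y) :
  strictly_convex h.
Proof.
  assert (Hlt : forall x y l, x < y -> 0 < l < 1 ->
    h (l * x + (1 - l) * y) < l * h x + (1 - l) * h y).
  { intros x y l Hxy Hl.
    set (z := l * x + (1 - l) * y).
    assert (Hyz : y - z = l * (y - x)) by (unfold z; ring).
    assert (Hzx : z - x = (1 - l) * (y - x)) by (unfold z; ring).
    assert (0 < l * (y - x)) by (apply Rmult_lt_0_compat; lra).
    assert (0 < (1 - l) * (y - x)) by (apply Rmult_lt_0_compat; lra).
    assert (Hd : forall c, derivable_pt_lim h c (dh c))
      by (intros c; apply is_derive_Reals, hd).
    destruct (MVT_cor2 h dh x z) as [c1 [H1 Hc1]]; [lra | auto |].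
    destruct (MVT_cor2 h dh z y) as [c2 [H2 Hc2]]; [lra | auto |].
    rewrite Hzx in H1; rewrite Hyz in H2.
    assert (Hdefect : l * h x + (1 - l) * h y - h z
                      = (dh c2 - dh c1) * (l * ((1 - l) * (y - x)))).
    { transitivity ((1 - l) * (h y - h z) - l * (h z - h x)); [ring |].
      rewrite H1, H2; ring. }
    assert (0 < (dh c2 - dh c1) * (l * ((1 - l) * (y - x)))).
    { apply Rmult_lt_0_compat; [| apply Rmult_lt_0_compat; lra].
      pose proof (hincr c1 c2); lra. }
    lra. }
  intros x y l Hxy Hl.
  destruct (Rtotal_order x y) as [H | [H | H]]; [auto | lra |].
  pose proof (Hlt y x (1 - l) H ltac:(lra)) as K.
  replace ((1 - l) * y + (1 - (1 - l)) * x) with (l * x + (1 - l) * y) in K by ring.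
  lra.
Qed.

Lemma is_derive_steklov (f : R -> R) (hf : forall x, continuous f x) (t x : R) :
  is_derive (fun x => steklov f x t) x (/ (2 * t) * (f (x + t) - f (x - t))).
Proof.
  unfold steklov.
  apply (is_derive_scal (fun x => RInt f (x - t) (x + t)) x (/ (2 * t))).
  evar_last.
  { apply (is_derive_RInt_bound_comp f (RInt f) (fun x => x - t) (fun x => x + t) 1 1 x).
    - apply filter_forall; intros [u v]; apply (RInt_correct (V := R_CompleteNormedModule)).
      apply (ex_RInt_continuous (V := R_CompleteNormedModule)); intros; apply hf.
    - apply hf.
    - apply hf.
    - auto_derive; [exact I | ring].
    - auto_derive; [exact I | ring]. }
  unfold minus, plus, opp, scal; simpl; unfold mult; simpl; ring.
Qed.

(** Let [X >= b] and [Y <= a] be points where [g] lies above, respectively below,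
    all its values over [[a, b]].  If one of [u], [v] lies in [[a, b]], a distance
    of [X - Y] forces the other one beyond [X] or [Y], where monotonicity of the
    tail keeps [g] outside that range.  If neither does, they lie either on the
    same tail, where [g] increases, or on opposite tails, where [g] has opposite
    signs. *)
Lemma lt_of_far_apart (g : R -> R) (a b : R)
  (hg : forall x, continuous g x) (hab : a < b)
  (ha_neg : forall x, x <= a -> g x < 0)
  (hb_pos : forall x, b <= x -> 0 < g x)
  (ha_incr : strictly_increasing_on (fun x => x <= a) g)
  (ha_unbdd : unbounded_below_on (fun x => x <= a) g)
  (hb_incr : strictly_increasing_on (fun x => b <= x) g)
  (hb_unbdd : unbounded_above_on (fun x => b <= x) g) :
  exists L, 0 < L /\ forall u v, L <= v - u -> g u < g v.
Proof.
  assert (Hcont : forall c, a <= c <= b -> continuity_pt g c)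
    by (intros c _; apply continuity_pt_filterlim, hg).
  destruct (continuity_ab_maj g a b ltac:(lra) Hcont) as [p [Hp _]].
  destruct (continuity_ab_min g a b ltac:(lra) Hcont) as [q [Hq _]].
  destruct (hb_unbdd (g p)) as [X [HbX HX]].
  destruct (ha_unbdd (g q)) as [Y [HYa HY]].
  exists (X - Y); split; [lra |].
  intros u v Huv.
  destruct (Rle_or_lt b v) as [Hv | Hv].
  - destruct (Rle_or_lt b u) as [Hu | Hu]; [apply hb_incr; lra |].
    destruct (Rle_or_lt u a) as [Hu' | Hu'].
    + pose proof (ha_neg u Hu'); pose proof (hb_pos v Hv); lra.
    + (* Here [a < u < b], so [v > X]. *)
      pose proof (hb_incr X v HbX Hv ltac:(lra)).
      pose proof (Hp u ltac:(lra)); lra.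
  - destruct (Rle_or_lt v a) as [Hv' | Hv']; [apply ha_incr; lra |].
    (* Here [a < v < b], so [u < Y]. *)
    pose proof (ha_incr u Y ltac:(lra) HYa ltac:(lra)).
    pose proof (Hq v ltac:(lra)); lra.
Qed.

Theorem theorem1 (f : R -> R) (a b : R)
  (hf : continuously_differentiable f)
  (hab : a < b)
  (ha_neg : forall x : R, x <= a -> Derive f x < 0)
  (ha_pos : forall x : R, b <= x -> 0 < Derive f x)
  (hb_incr : strictly_increasing_on (fun x => x <= a) (Derive f))
  (hb_unbdd : unbounded_below_on (fun x => x <= a) (Derive f))
  (hc_incr : strictly_increasing_on (fun x => b <= x) (Derive f))
  (hc_unbdd : unbounded_above_on (fun x => b <= x) (Derive f)) :
  exists t0 : R, 0 < t0 /\
    forall t : R, t0 <= t -> strictly_convex (fun x : R => steklov f x t).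
Proof.
  destruct hf as [Hd Hdc].
  destruct (lt_of_far_apart (Derive f) a b) as [L [HL Hfar]]; try assumption.
  exists (L / 2); split; [lra |].
  intros t Ht.
  apply strictly_convex_of_deriv
    with (dh := fun x => / (2 * t) * (f (x + t) - f (x - t))).
  { intros x; apply is_derive_steklov.
    intros y; apply (ex_derive_continuous (V := R_NormedModule)), Hd. }
  apply increasing_of_deriv_pos
    with (dh := fun x => / (2 * t) * (Derive f (x + t) - Derive f (x - t))).
  - intros x; auto_derive; [auto |].
    rewrite !Rmult_1_l; reflexivity.
  - intros x; apply Rmult_lt_0_compat; [apply Rinv_0_lt_compat; lra |].
    pose proof (Hfar (x - t) (x + t) ltac:(lra)); lra.
Qed.
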